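(* Let $(X,f)$ be a topological dynamical system satisfying the non-uniform $\tau$-specification property. Then $$\max\bigg\{h_{top}^B\Big(f,\ \mathrm{IR}(f)\cap\mathrm{Trans}(f)\Big),\ h_{top}^B\Big(f,\ \Big(\bigcup_{\omega\in\mathcal{M}_f(X)\setminus\mathcal{M}_f^{erg}(X)}G_\omega\Big)\cap\mathrm{Trans}(f)\Big)\bigg\}\ \ge\ \frac{1}{(1+\tau)^2}\,h_{top}(f).$$
   Context: Here $\tau\in[0,\infty]$; if $\tau=\infty$ the right-hand side is read as $0$. A topological dynamical system $(X,f)$ consists of a compact metric space $(X,d)$ with at least two points and a continuous map $f:X\to X$. $C(X)$ is the space of real continuous functions on $X$; $\mathcal{M}_f(X)$, $\mathcal{M}_f^{erg}(X)$ are the $f$-invariant, resp. $f$-ergodic, Borel probability measures; $h_{top}(f)$ is topological entropy. For $\omega\in\mathcal{M}_f(X)$, $G_\omega=\{x\in X:\frac1n\sum_{k=0}^{n-1}\delta_{f^kx}\to\omega\text{ in the weak}^*\text{ topology}\}$ is the set of generic points of $\omega$. $\mathrm{Trans}(f)=\{x\in X:\omega(x,f)=X\}$, where $\omega(x,f)$ is the $\omega$-limit set of $x$. For $\varphi\in C(X)$, $I_\varphi(f)=\{x\in X:\lim_{n\to\infty}\frac1n\sum_{k=0}^{n-1}\varphi(f^kx)\text{ does not exist}\}$; $\mathrm{IR}(f)=\bigcup_{\varphi\in C(X)}I_\varphi(f)$. Non-uniform specification: $(X,f)$ has the non-uniform specification property with gap function $M:\mathbb{N}\times(0,\infty)\to\mathbb{N}$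 ($\mathbb{N}$ the positive integers) if $M(n,\varepsilon)$ is non-decreasing in $n$ and non-increasing in $\varepsilon$, and for every $\varepsilon>0$, every integer $k\ge2$, all $x_1,\dots,x_k\in X$ and all non-negative integers $a_1\le b_1<a_2\le b_2<\cdots<a_k\le b_k$ with $a_{i+1}-b_i\ge M(b_i-a_i+1,\varepsilon)$ for $1\le i\le k-1$, there is $z\in X$ with $d(f^{n-a_i}x_i,f^nz)\le\varepsilon$ for all $a_i\le n\le b_i$, $1\le i\le k$. Let $\mathscr{G}(X,f)$ be the set of all such gap functions for $(X,f)$ and $\tau(M)=\sup_{\varepsilon>0}\liminf_{n\to\infty}M(n,\varepsilon)/n\in[0,\infty]$. $(X,f)$ has the non-uniform $\tau$-specification property if there is $M\in\mathscr{G}(X,f)$ with $\tau(M)=\tau$ and every $M'\in\mathscr{G}(X,f)$ satisfies $\tau(M')\ge\tau$. Bowen topological entropy of $F\subset X$: let $B_n(x,\varepsilon)=\{y:\max_{0\le i\le n-1}d(f^ix,f^iy)<\varepsilon\}$. For $t\ge0$ let $C(F;t,N,\varepsilon,f)$ be the infimum of $\sum_k e^{-tn_k}$ over finite or countable covers $\{B_{n_k}(x_k,\varepsilon)\}$ of $F$ with $x_k\in F$, $n_k\ge N$; let $C(F;t,\varepsilon,f)=\lim_{N\to\infty}C(F;t,N,\varepsilon,f)$, $h_{top}^B(F;\varepsilon,f)=\inf\{t\ge0:C(F;t,\varepsilon,f)=0\}$ and $h_{top}^B(f,F)=\lim_{\varepsilon\to0}h_{top}^B(F;\varepsilon,f)$.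 *)

(* Defs.v *)
From HB Require Import structures.
From mathcomp Require Import all_boot all_order all_algebra finmap.
From mathcomp Require Import all_classical all_reals all_analysis.

Set Implicit Arguments.
Unset Strict Implicit.
Unset Printing Implicit Defensive.

Import Order.TTheory GRing.Theory Num.Theory.
Import numFieldNormedType.Exports.

Local Open Scope classical_set_scope.
Local Open Scope ring_scope.

(* Measurable types are pointed, so a metric space carrying a Borel sigma-algebra
   must be pointed too; the point only records non-emptiness. *)
#[short(type="pmetricType")]
HB.structure Definition PointedMetric (K : numDomainType) :=
  {M of Metric K M & Pointed M}.

Notation borel X := (g_sigma_algebraType (@open X)).

Section Dynamics.
Context {R : realType} {X : pmetricType R}.
Implicit Types (f : X -> X) (F : set X) (x y : X) (phi : X -> R) (e t : R).

Definition birkhoff f phi x (n : nat) : R :=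
  n%:R^-1 * \sum_(k < n) phi (iter k f x).

Definition irregular_for f phi : set X := [set x | ~ cvgn (birkhoff f phi x)].

Definition IR f : set X :=
  \bigcup_(phi in [set phi : X -> R | continuous phi]) irregular_for f phi.

Definition omega_limit f x : set X := cluster ((fun n => iter n f x) @ \oo).

Definition Trans f : set X := [set x | omega_limit f x = [set: X]].

Definition invariant_measures f : set (probability (borel X) R) :=
  [set mu | forall A, (@open X).-sigma.-measurable A ->
     mu (f @^-1` A) = mu A].

Definition ergodic_measures f : set (probability (borel X) R) :=
  [set mu | invariant_measures f mu /\
     forall A, (@open X).-sigma.-measurable A -> f @^-1` A = A ->
       mu A = 0%E \/ mu A = 1%E].

(* At n = 0 this is the zero measure, which limits in n ignore. *)
Definition empirical f x (n : nat) : {measure set (borel X) -> \bar R} :=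
  mscale (n%:R^-1)%:nng
    (msum (fun k => dirac (iter k f x : borel X)) n).

Definition weak_star_cvg (mu : nat -> {measure set (borel X) -> \bar R})
    (nu : {measure set (borel X) -> \bar R}) : Prop :=
  forall phi, continuous phi ->
    \int[mu n]_x phi x @[n --> \oo] --> \int[nu]_x phi x.

Definition generic f (nu : probability (borel X) R) : set X :=
  [set x | weak_star_cvg (empirical f x) nu].

Definition bowen_dist f (n : nat) x y : R :=
  \big[Num.max/0]_(i < n) mdist (iter i f x) (iter i f y).

Definition bowen_ball f (n : nat) x e : set X :=
  [set y | bowen_dist f n x y < e].

(* Bowen's definition of the topological entropy of (X, f):
   lim_(e -> 0) limsup_n (1/n) log s_n(e), where s_n(e) is the largest
   cardinality of an (n, e)-separated set. *)
Definition separated f (n : nat) e (E : {fset X}) : Prop :=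
  forall x y, x \in E -> y \in E -> x != y -> e < bowen_dist f n x y.

Definition max_separated f (n : nat) e : \bar R :=
  ereal_sup [set (#|` E|%fset%:R)%:E | E in separated f n e].

Definition h_top f : \bar R :=
  lim (limn_esup (fun n => (n%:R^-1)%:E * lne (max_separated f n e))%E
       @[e --> 0^'+]).

(* Finite and countable families of Bowen balls are indexed by arbitrary sets
   D of natural numbers. *)
Definition bowen_cover f F (N : nat) e
    (D : set nat) (c : nat -> X) (m : nat -> nat) : Prop :=
  [/\ forall k, D k -> F (c k), forall k, D k -> (N <= m k)%N &
      F `<=` \bigcup_(k in D) bowen_ball f (m k) (c k) e].

Definition bowen_sum_N f F t (N : nat) e : \bar R :=
  ereal_inf [set s | exists (D : set nat) (c : nat -> X) (m : nat -> nat),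
    bowen_cover f F N e D c m /\
    s = (\esum_(k in D) (expR (- t * (m k)%:R))%:E)%E].

Definition bowen_sum f F t e : \bar R :=
  limn (fun N => bowen_sum_N f F t N e).

Definition bowen_entropy_at f F e : \bar R :=
  ereal_inf [set t%:E | t in [set t | 0 <= t /\ bowen_sum f F t e = 0%E]].

Definition bowen_entropy f F : \bar R :=
  lim (bowen_entropy_at f F e @[e --> 0^'+]).

(* A gap function is defined on positive n and e only; its values elsewhere
   are irrelevant. The points and times are indexed by 0, ..., k - 1. *)
Definition gap_function f (M : nat -> R -> nat) : Prop :=
  [/\ forall n e, (0 < n)%N -> 0 < e -> (0 < M n e)%N,
      forall n n' e, (0 < n)%N -> (n <= n')%N -> 0 < e -> (M n e <= M n' e)%N,
      forall n e e', (0 < n)%N -> 0 < e -> e <= e' -> (M n e' <= M n e)%N &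
      forall e (k : nat) (p : nat -> X) (a b : nat -> nat),
        0 < e -> (2 <= k)%N ->
        (forall i, (i < k)%N -> (a i <= b i)%N) ->
        (forall i, (i.+1 < k)%N -> (b i < a i.+1)%N) ->
        (forall i, (i.+1 < k)%N ->
           (M (b i - a i + 1)%N e <= a i.+1 - b i)%N) ->
        exists z, forall i n, (i < k)%N -> (a i <= n <= b i)%N ->
          mdist (iter (n - a i) f (p i)) (iter n f z) <= e].

Definition gap_rate (M : nat -> R -> nat) : \bar R :=
  ereal_sup [set limn_einf (fun n => ((M n e)%:R / n%:R)%:E)
            | e in [set e : R | 0 < e]].

Definition nonuniform_specification f (tau : \bar R) : Prop :=
  (exists2 M, gap_function f M & gap_rate M = tau) /\
  (forall M, gap_function f M -> (tau <= gap_rate M)%E).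

End Dynamics.

(* Main.v *)
(* The set IR(f) `&` Trans(f) alone carries the entropy, and no measure is needed.
   Fix a scale d and h < h_top(f), then a block length n with gap g = M n d <= tau' n,
   period p = n + g, and (n, 12d)-separated points x_0, ..., x_(q-1) with
   q >= exp(h n) > p.  Points are built in stages: the orbit up to time T is
   shadowed ever more closely, and after gaps it visits the next term of a dense
   sequence (transitivity) and then follows, with period p, the blocks of
   0^m 1^m ... (q-1)^m s, where m p is a fixed proportion of T and s is an arbitrary
   word, much longer than T.
   Irregularity: bump functions phi_a around the Bowen balls of the x_a have disjoint
   supports, so convergent averages c_a would satisfy sum c_a <= 1, whereas the runs
   a^m force c_a >= 1/p, hence q <= p.
   Entropy: the free words give rate h n / p >= h / (1 + tau'), of which a fraction
   about 1 / (1 + tau') survives at the end of the gap following a stage; given a cover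
   by Bowen balls of small total weight, the free words can be chosen stage by
   stage so that the limit point avoids all of them. *)

Require Import Defs.
From mathcomp Require Import all_boot all_order all_algebra finmap.
From mathcomp Require Import all_classical all_reals all_analysis.
From mathcomp Require Import zify ring lra.

Set Implicit Arguments.
Unset Strict Implicit.
Unset Printing Implicit Defensive.
Import Order.TTheory GRing.Theory Num.Theory.
Import numFieldNormedType.Exports.
Local Open Scope classical_set_scope.
Local Open Scope ring_scope.

(** * Bowen distances *)

Section BowenMetric.
Context {R : realType} {X : pmetricType R}.
Implicit Types (f : X -> X) (x y z : X) (e : R) (n : nat).

Lemma bowen_dist_leP f n x y e : 0 <= e ->
  reflect (forall i, (i < n)%N -> mdist (iter i f x) (iter i f y) <= e)
          (bowen_dist f n x y <= e).
Proof.
move=> e0; apply: (iffP (bigmax_leP _ _ _ _)) => [[_ h] i lt_in|h].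
  exact: (h (Ordinal lt_in)).
by split=> // i _; apply: h.
Qed.

Lemma bowen_dist_ltP f n x y e : 0 < e ->
  reflect (forall i, (i < n)%N -> mdist (iter i f x) (iter i f y) < e)
          (bowen_dist f n x y < e).
Proof.
move=> e0; apply: (iffP (bigmax_ltP _ _ _ _)) => [[_ h] i lt_in|h].
  exact: (h (Ordinal lt_in)).
by split=> // i _; apply: h.
Qed.

Lemma bowen_dist_ge0 f n x y : 0 <= bowen_dist f n x y.
Proof. exact: bigmax_ge_id. Qed.

Lemma mdist_le_bowen_dist f n x y i : (i < n)%N ->
  mdist (iter i f x) (iter i f y) <= bowen_dist f n x y.
Proof. exact: (bowen_dist_leP f n x y (bowen_dist_ge0 f n x y) (lexx _)). Qed.

Lemma bowen_dist_sym f n x y : bowen_dist f n x y = bowen_dist f n y x.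
Proof. by apply: eq_bigr => i _; rewrite metric_sym. Qed.

Lemma bowen_dist_triangle f n x y z :
  bowen_dist f n x z <= bowen_dist f n x y + bowen_dist f n y z.
Proof.
apply/bowen_dist_leP => [|i lt_in]; first by rewrite addr_ge0 ?bowen_dist_ge0.
apply: le_trans (metric_triangle _ (iter i f y) _) _.
by rewrite lerD ?mdist_le_bowen_dist.
Qed.

Lemma continuous_iter f n : continuous f -> continuous (iter n f).
Proof.
move=> fc; elim: n => [|n IH] x; first exact: cvg_id.
by apply: (@continuous_comp _ _ _ (iter n f) f); [exact: IH|exact: fc].
Qed.

Lemma continuous_mdist x : continuous (mdist x : X -> R).
Proof.
move=> y; apply/cvgrPdist_lt => e e0.
have : nbhs y (ball y e) by exact: nbhsx_ballx.
apply: filterS => z; rewrite ballEmdist/= => yz.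
rewrite (le_lt_trans _ yz)// ler_norml.
have := metric_triangle x y z; have := metric_triangle x z y.
rewrite (metric_sym z y) => h1 h2; lra.
Qed.

Lemma continuous_bowen_dist f n x :
  continuous f -> continuous (bowen_dist f n x).
Proof.
move=> fc; elim: n x => [|n IH] x.
  have -> : bowen_dist f 0 x = cst 0.
    by apply/funext => y; rewrite /bowen_dist big_ord0.
  by move=> y; exact: cvg_cst.
have -> : bowen_dist f n.+1 x = mdist x \max (bowen_dist f n (f x) \o f).
  apply/funext => y; rewrite /bowen_dist big_ord_recl/=.
  by congr Num.max; apply: eq_bigr => i _; rewrite -!iterSr.
move=> y; apply: continuous_max; first exact: continuous_mdist.
by apply: continuous_comp; [exact: fc|exact: IH].
Qed.

End BowenMetric.

(** * Separated sets and topological entropy *)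

Section SeparatedSets.
Context {R : realType} {X : pmetricType R}.
Implicit Types (f : X -> X) (e h : R) (n : nat).
Local Open Scope fset_scope.

Lemma le_limn_esup (u v : nat -> \bar R) :
  (forall n, (u n <= v n)%E) -> (limn_esup u <= limn_esup v)%E.
Proof.
move=> uv; rewrite /limn_esup !limf_esupE.
apply: le_ereal_inf_tmp => _ [V VF <-].
apply: (@le_trans _ _ (ereal_sup (u @` V))); first by apply: ereal_inf_lbound; exists V.
apply: ge_ereal_sup => _ [n Vn <-]; apply: (le_trans (uv n)).
by apply: ereal_sup_ubound; exists n.
Qed.

Lemma limn_esup_le_near (u : nat -> \bar R) (l : \bar R) :
  (\forall n \near \oo, (u n <= l)%E) -> (limn_esup u <= l)%E.
Proof.
move=> ul; rewrite /limn_esup limf_esupE.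
apply: (@le_trans _ _ (ereal_sup (u @` [set n | (u n <= l)%E]))).
  by apply: ereal_inf_lbound; exists [set n | (u n <= l)%E].
by apply: ge_ereal_sup => _ [n un <-].
Qed.

Lemma max_separated_ge0 f n e : (0 <= max_separated f n e)%E.
Proof. by apply: ereal_sup_ubound; exists fset0 => //=; rewrite cardfs0. Qed.

Lemma le_max_separated f n e e' : e <= e' ->
  (max_separated f n e' <= max_separated f n e)%E.
Proof.
move=> ee'; apply: ereal_sup_le => _ [E sepE <-]; exists E => // x y xE yE xy.
exact: le_lt_trans ee' (sepE x y xE yE xy).
Qed.

(** The growth rate is nonincreasing in [e], so its limit at [0^'+] is a supremum. *)
Lemma h_top_lt f h : (h%:E < h_top f)%E -> exists2 e, 0 < e &
  (h%:E < limn_esup (fun n => (n%:R^-1)%:E * lne (max_separated f n e)))%E.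
Proof.
pose F e := limn_esup (fun n => ((n%:R^-1)%:E * lne (max_separated f n e))%E).
have Fmono : {in Interval (BRight 0) (BInfty R false) &, nonincreasing_fun F}.
  move=> e e' _ _ ee'; apply: le_limn_esup => n; rewrite lee_wpmul2l//.
  by rewrite lee_lne ?in_itv/= ?max_separated_ge0 ?leey// le_max_separated.
have /cvg_lim Fcvg := nonincreasing_at_right_cvge (BInfty R false) isT Fmono.
rewrite /h_top -/F Fcvg// => /ereal_sup_gt[_ [e + <-] he].
by rewrite /= in_itv/= andbT => e0; exists e.
Qed.

(** A separated set of largest cardinality spans: a point farther than [e] from all of it could be
    added. *)
Lemma maximal_separated f n e (B : nat) : 0 < e ->
    (forall E : {fset X}, Defs.separated f n e E -> (#|` E| <= B)%N) ->
  exists2 E : {fset X}, Defs.separated f n e E &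
    forall x, exists2 y, y \in E & bowen_dist f n x y <= e.
Proof.
move=> e0 leB.
pose P k := `[< exists2 E : {fset X}, Defs.separated f n e E & #|` E| = k >].
have exP : exists k, P k by exists 0%N; apply/asboolP; exists fset0; rewrite ?cardfs0.
have ubP k : P k -> (k <= B)%N by move=> /asboolP[E /leB + <-].
case: (ex_maxnP exP ubP) => k /asboolP[E sepE <-] maxE; exists E => // x.
apply: contrapT => far.
have far' y : y \in E -> e < bowen_dist f n x y.
  by move=> yE; rewrite ltNge; apply/negP => xy; apply: far; exists y.
have xE : x \notin E.
  apply/negP => /far'; apply/negP; rewrite -leNgt.
  by apply/bowen_dist_leP => [|i _]; rewrite ?mdistxx ltW.
suff : (#|` x |` E| <= #|` E|)%N by rewrite cardfsU1 xE ltnn.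
apply: maxE; apply/asboolP; exists (x |` E) => // y z.
rewrite !in_fset1U => /predU1P[->|yE] /predU1P[->|zE] yz.
- by rewrite eqxx in yz.
- exact: far'.
- by rewrite bowen_dist_sym; exact: far'.
- exact: sepE.
Qed.

(* Cutting an orbit into blocks of length [N] codes it by [k] points of a spanning set. *)
Lemma card_separated_mul f n N k e (E0 : {fset X}) (E : {fset X}) :
    (n <= k * N)%N -> 0 < e ->
    (forall x, exists2 y, y \in E0 & bowen_dist f N x y <= e) ->
    Defs.separated f n (2 * e) E ->
  (#|` E| <= #|` E0| ^ k)%N.
Proof.
move=> nkN e0 span sepE.
have : forall x, exists y : E0, bowen_dist f N x (val y) <= e.
  by move=> x; have [y yE0 xy] := span x; exists [` yE0].
case/choice=> g gP.
pose c (x : E) := [ffun i : 'I_k => g (iter (i * N) f (val x))].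
have cI : injective c.
  move=> x y cxy; apply: val_inj; apply/eqP/negPn/negP => xy.
  have := sepE _ _ (valP x) (valP y) xy; apply/negP; rewrite -leNgt.
  apply/bowen_dist_leP => [|j jn]; first by lra.
  have N0 : (0 < N)%N by case: N nkN {gP c cxy span} => // ; lia.
  have jk : (j %/ N < k)%N by rewrite ltn_divLR// (leq_trans jn).
  move/ffunP/(_ (Ordinal jk)): cxy; rewrite !ffunE/= => gxy.
  have itE z : iter j f z = iter (j %% N) f (iter (j %/ N * N) f z).
    by rewrite -iterD {1}(divn_eq j N) addnC.
  have jN : (j %% N < N)%N by rewrite ltn_mod.
  have gx := le_trans (mdist_le_bowen_dist f _ _ jN) (gP (iter (j %/ N * N) f (val x))).
  have gy := le_trans (mdist_le_bowen_dist f _ _ jN) (gP (iter (j %/ N * N) f (val y))).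
  rewrite !itE; apply: le_trans (metric_triangle _ _ _) _; rewrite mulr2n mulrDl mul1r.
  apply: lerD; first exact: gx.
  by rewrite metric_sym gxy.
by have := leq_card c cI; rewrite card_ffun card_ord -!cardfE.
Qed.

(** Small gaps are guaranteed only at some lengths, so the bound is needed at every [n] for one
    scale. If it failed at [N], coding by a maximal separated set would allow at most
    [expR (h * (n + N))] points for every [n], and the limsup would be at most [h]. *)
Lemma separated_lower_bound f h : 0 <= h -> (h%:E < h_top f)%E ->
  exists2 e, 0 < e & forall n, (0 < n)%N ->
    exists2 E : {fset X}, Defs.separated f n e E & expR (h * n%:R) <= (#|` E|)%:R.
Proof.
move=> h0 /h_top_lt[e2 e20 hlt]; exists (e2 / 2); first by lra.
move=> N N0; apply: contrapT => noE.
have e0 : 0 < e2 / 2 by lra.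
have few (E : {fset X}) : Defs.separated f N (e2 / 2) E ->
    (#|` E|)%:R < expR (h * N%:R) :> R.
  by move=> sepE; rewrite ltNge; apply/negP => hE; apply: noE; exists E.
have fewB (E : {fset X}) : Defs.separated f N (e2 / 2) E ->
    (#|` E| <= Num.bound (expR (h * N%:R) : R))%N.
  move=> /few/ltW/le_lt_trans/(_ (archi_boundP (expR_ge0 _))).
  by rewrite ltr_nat => /ltnW.
have [E0 sepE0 span] := maximal_separated e0 fewB.
have bound n : (max_separated f n e2 <= (expR (h * (n + N)%:R))%:E)%E.
  apply: ge_ereal_sup => _ [E sepE <-]; rewrite lee_fin.
  have sepE' : Defs.separated f n (2 * (e2 / 2)) E.
    by rewrite (_ : 2 * (e2 / 2) = e2)//; lra.
  have nk : (n <= (n %/ N).+1 * N)%N by rewrite ltnW// mulSn addnC {1}(divn_eq n N) ltn_add2l ltn_mod.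
  have := card_separated_mul nk e0 span sepE'; rewrite -(ler_nat R) => /le_trans; apply.
  rewrite natrX; apply: (@le_trans _ _ (expR (h * N%:R) ^+ (n %/ N).+1)).
    by rewrite lerXn2r ?nnegrE// ?expR_ge0// ltW// few.
  rewrite -expRM_natl ler_expR mulrCA ler_wpM2l// -natrM ler_nat.
  by have := leq_trunc_div n N; lia.
have : (limn_esup (fun n => (n%:R^-1)%:E * lne (max_separated f n e2)) <= h%:E)%E.
  apply/lee_addgt0Pr => d d0; apply: limn_esup_le_near.
  exists (Num.bound (h * N%:R / d)).+1 => // n /= nb.
  have n0 : 0 < n%:R :> R by rewrite ltr0n; lia.
  have : (lne (max_separated f n e2) <= (h * (n + N)%:R)%:E)%E.
    rewrite -[X in (_ <= X%:E)%E]expRK -lne_EFin ?expR_gt0//.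
    by rewrite lee_lne ?in_itv/= ?max_separated_ge0 ?leey ?lee_fin ?expR_ge0.
  move=> /(lee_wpmul2l (x := (n%:R^-1)%:E)) /le_trans; apply.
    by rewrite lee_fin invr_ge0 ltW.
  rewrite -EFinM -EFinD lee_fin ler_pdivrMl// natrD.
  have hb : h * N%:R < n%:R * d.
    rewrite -ltr_pdivrMr//; apply: lt_trans (archi_boundP _) _.
      by rewrite divr_ge0 ?mulr_ge0// ltW.
    by rewrite ltr_nat.
  lra.
by rewrite leNgt hlt.
Qed.

End SeparatedSets.

(** * Gap functions *)

Section Gluing.
Context {R : realType} {X : pmetricType R}.
Implicit Types (f : X -> X) (M : nat -> R -> nat) (e t : R) (x y z : X).

Lemma gap_rate_frequently M t t' e (N : nat) :
    gap_rate M = t%:E -> t < t' -> 0 < e ->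
  exists2 n, (N <= n)%N & (M n e)%:R <= t' * n%:R.
Proof.
move=> Mt tt' e0; apply: contrapT => noM.
have : (limn_einf (fun n => ((M n e)%:R / n%:R)%:E) <= t%:E)%E.
  by rewrite -Mt; apply: ereal_sup_ubound; exists e.
apply/negP; rewrite -ltNge; apply: (@lt_le_trans _ _ t'%:E); first by rewrite lte_fin.
rewrite leeNr; apply: limn_esup_le_near; exists N.+1 => // n /= Nn.
rewrite lee_fin lerN2 ler_pdivlMr; last by rewrite ltr0n; lia.
by apply: contrapT => /negP; rewrite -ltNge => /ltW h; apply: noM; exists n => //; lia.
Qed.

(** A good length for the intermediate rate [t2] is rounded down into the progression. Monotonicity
    of [M] controls the gap, and the loss [t2 * p] is absorbed once [A + K * p] exceeds
    [t2 * p / (t' - t2)]. *)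
Lemma gap_rate_frequently_mod f M t t' e (A p N : nat) :
    gap_function f M -> gap_rate M = t%:E -> 0 <= t -> t < t' -> 0 < e -> (0 < p)%N ->
  exists2 K, (N <= K)%N & (M (A + K * p)%N e)%:R <= t' * (A + K * p)%N%:R.
Proof.
move=> [_ Mmono _ _] Mt t0 tt' e0 p0.
pose t2 := (t + t') / 2; have tt2 : t < t2 by rewrite /t2; lra.
have t2t' : 0 < t' - t2 by rewrite /t2; lra.
pose B := Num.bound (t2 * p%:R / (t' - t2)).
have [T TN MT] := gap_rate_frequently (A + N.+1 * p + B.+1 * p)%N Mt tt2 e0.
have Tdiv := divn_eq (T - A) p; have Tmod := ltn_pmod (T - A) p0.
pose K := ((T - A) %/ p)%N; exists K.
  by rewrite leq_divRL//; rewrite mulSn in TN; lia.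
have AK : (A + K * p <= T < A + K * p + p)%N by rewrite /K; lia.
have BK : (B < A + K * p)%N.
  have : (B.+1 <= B.+1 * p)%N by rewrite leq_pmulr.
  by move: TN; rewrite (mulSn N); lia.
have Bt : t2 * p%:R / (t' - t2) < (A + K * p)%N%:R.
  apply: lt_trans (archi_boundP _) _; last by rewrite ltr_nat.
  by rewrite divr_ge0 ?(ltW t2t')// mulr_ge0//; lra.
rewrite ltr_pdivrMr// in Bt.
have TK : T%:R <= (A + K * p)%N%:R + p%:R :> R by rewrite -natrD ler_nat; lia.
have MM : (M (A + K * p)%N e)%:R <= (M T e)%:R :> R by rewrite ler_nat Mmono//; lia.
have := ler_wpM2l (ltW (le_lt_trans t0 tt2)) TK.
set a := (A + K * p)%N%:R in Bt MM TK *; nra.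
Qed.

(** The required gap depends only on the length of the block before it, so blocks of equal length
    fit a constant period. *)
Lemma glue_blocks f M e (n L : nat) (x : nat -> X) :
    gap_function f M -> 0 < e -> (0 < n)%N -> (2 <= L)%N ->
  exists w, forall i l, (i < L)%N -> (l < n)%N ->
    mdist (iter l f (x i)) (iter (i * (n + M n e) + l) f w) <= e.
Proof.
move=> [Mpos _ _ spec] e0 n0 L2; pose p := (n + M n e)%N.
have [|||w wP] := spec e L x (fun i => i * p)%N (fun i => i * p + n.-1)%N e0 L2.
- by move=> i _; lia.
- by move=> i _; rewrite mulSn; lia.
- move=> i _; rewrite mulSn (_ : (_ - _ + 1)%N = n); last by lia.
  by rewrite /p; lia.
exists w => i l iL ln; have := wP i (i * p + l)%N iL.
by rewrite addKn; apply; lia.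
Qed.

(** The last piece is followed by no gap, so [len] is free; only the prefix and the single visit to
    [y] are charged. *)
Lemma glue_stage f M e (T len : nat) z y w :
    gap_function f M -> 0 < e -> (0 < T)%N -> (0 < len)%N ->
  exists z', [/\ forall i, (i < T)%N -> mdist (iter i f z) (iter i f z') <= e,
    mdist y (iter (T + M T e) f z') <= e &
    forall i, (i < len)%N ->
      mdist (iter i f w) (iter (T + M T e + M 1%N e + i) f z') <= e].
Proof.
move=> [Mpos _ _ spec] e0 T0 len0; pose S := (T + M T e + M 1%N e)%N.
have M1 := Mpos 1%N e isT e0.
(* The third point, start and end are the defaults of [nth]. *)
have [|||z' z'P] := spec e 3%N (fun i => nth w [:: z; y] i)
  (fun i => nth S [:: 0; T + M T e] i)%N
  (fun i => nth (S + len.-1) [:: T.-1; T + M T e] i)%N e0 isT.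
- by case=> [|[|[|i]]]//= _; rewrite ?nth_nil; lia.
- by case=> [|[|i]]//= _; rewrite /S; lia.
- case=> [|[|i]]//= _.
    by rewrite (_ : (_ - _ + 1)%N = T); lia.
  by rewrite subnn add0n /S; lia.
exists z'; split.
- by move=> i iT; have := z'P 0%N i isT; rewrite /= subn0; apply; lia.
- by have := z'P 1%N (T + M T e)%N isT; rewrite /= subnn; apply; rewrite !leqnn.
- move=> i il; have := z'P 2%N (S + i)%N isT; rewrite /= addKn; apply; lia.
Qed.

End Gluing.

(** * Counting *)

Section Counting.
Context {R : realType}.

Lemma card_agree_prefix (q K I : nat) (P : {pred {ffun 'I_K -> 'I_q}}) :
    (I <= K)%N ->
    (forall s s', s \in P -> s' \in P -> forall i : 'I_K, (i < I)%N -> s i = s' i) ->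
  (#|P| * q ^ I <= q ^ K)%N.
Proof.
move=> IK agree; rewrite -[K in (_ <= q ^ K)%N](subnK IK) expnD leq_mul2r; apply/orP; right.
have shiftP (j : 'I_(K - I)) : (I + j < K)%N by have := ltn_ord j; lia.
pose g (s : {ffun 'I_K -> 'I_q}) := [ffun j => s (Ordinal (shiftP j))].
have gI : {in P &, injective g}.
  move=> s s' sP s'P /ffunP ss'; apply/ffunP => i.
  have [/(agree _ _ sP s'P)//|Ii] := ltnP i I.
  have iK : (i - I < K - I)%N by have := ltn_ord i; lia.
  have := ss' (Ordinal iK); rewrite !ffunE.
  by congr (s _ = s' _); apply: val_inj; rewrite /= subnKC.
rewrite -(card_in_imset gI); apply: leq_trans (max_card _) _.
by rewrite card_ffun !card_ord.
Qed.

(* One step of the method of conditional expectations, with countably many events. *)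
Lemma exists_child_below_average (S : finType) (D : set nat)
    (b : S -> nat -> R) (a : nat -> R) :
    (0 < #|S|)%N -> (forall s k, 0 <= b s k) -> (forall k, 0 <= a k) ->
    (forall k, D k -> \sum_s b s k <= #|S|%:R * a k) ->
    (\esum_(k in D) (a k)%:E < 1)%E ->
  exists s, (\esum_(k in D) (b s k)%:E < 1)%E.
Proof.
move=> S0 b0 a0 ba a1; apply: contrapT => /forallNP nob.
have b1 s : (1 <= \esum_(k in D) (b s k)%:E)%E by rewrite leNgt; apply/negP/nob.
have : (\sum_(s : S) 1 <= \sum_(s : S) \esum_(k in D) (a k)%:E)%E.
  apply: (@le_trans _ _ (\sum_(s : S) \esum_(k in D) (b s k)%:E)%E).
    by apply: lee_sum => s _; exact: b1.
  rewrite -!esum_sum; [|by move=> *; rewrite lee_fin..].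
  apply: le_esum => k Dk; rewrite !sumEFin lee_fin.
  by rewrite sumr_const -[leRHS]mulr_natl cardT -cardE; exact: ba.
have r0 : (0 <= \esum_(k in D) (a k)%:E)%E by apply: esum_ge0 => k _; rewrite lee_fin.
case: (\esum_(k in D) (a k)%:E)%E a1 r0 => [r| |]//; rewrite lte_fin => r1 _.
rewrite !sumEFin lee_fin !sumr_const lerMn2r gtn_eqF//=.
by rewrite leNgt r1.
Qed.

(** Number of periods of the [i]-th free word completed by time [m]; truncated subtraction gives 0
    when [m <= A i]. *)
Definition free_blocks (A K : nat -> nat) (p m i : nat) : nat :=
  minn (K i) ((m - A i) %/ p).

(* The worst case is [m = A j], where the last free word ended at [T j >= A j / D]. *)
Lemma sum_free_blocks_ge (T A K : nat -> nat) (p k0 : nat) (D : R) (m : nat) :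
    (0 < p)%N -> (1 < k0)%N -> 1 <= D ->
    (forall j, (T j <= A j)%N) -> (forall j, (j < A j)%N) ->
    (forall j, T j.+1 = A j + K j * p)%N ->
    (forall j, (k0 * A j <= T j.+1)%N) ->
    (forall j, (A j)%:R <= D * (T j)%:R) ->
    (A 1 <= m)%N ->
  (1 - k0%:R^-1) / D * m%:R - p%:R <=
    p%:R * (\sum_(0 <= i < m) free_blocks A K p m i)%N%:R.
Proof.
move=> p0 k01 D1 TA ltA TS kA AD A1m.
have exJ : exists J, (A J <= m)%N by exists 1%N.
have ubJ J : (A J <= m)%N -> (J <= m)%N by have := ltA J; lia.
case: (ex_maxnP exJ ubJ) => -[|J]; first by move=> _ /(_ 1%N A1m).
move=> AJm maxJ.
have mAJ : (m < A J.+2)%N by rewrite ltnNge; apply/negP => /maxJ; lia.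
have [l lE] : exists l : R, l = (1 - k0%:R^-1) / D by eexists.
rewrite -lE.
have k0R : 1 < k0%:R :> R by rewrite ltr1n.
have ik0 : 0 < (k0%:R : R)^-1 < 1.
  by rewrite invr_gt0 invf_lt1 ?k0R ?andbT; lra.
have lD : l * D = 1 - k0%:R^-1 by rewrite lE divfK//; lra.
have l0 : 0 <= l by rewrite lE divr_ge0; lra.
have l1 : l <= 1 by nra.
(* As [A j] is at most [T j.+1 / k0], the free word fills at least the proportion [1 - 1 / k0] of
   the time up to [T j.+1]. *)
have Kp j : (1 - k0%:R^-1) * (T j.+1)%:R <= (K j)%:R * p%:R :> R.
  have kAR : k0%:R * (A j)%:R <= (T j.+1)%:R :> R by rewrite -natrM ler_nat.
  have TSR : (T j.+1)%:R = (A j)%:R + (K j)%:R * p%:R :> R by rewrite TS natrD natrM.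
  have : (A j)%:R <= k0%:R^-1 * (T j.+1)%:R :> R by rewrite ler_pdivlMl//; lra.
  lra.
have lA j : l * (A j)%:R <= (1 - k0%:R^-1) * (T j)%:R.
  by rewrite -lD -mulrA ler_wpM2l.
have FJ : free_blocks A K p m J = K J.
  apply/minn_idPl; rewrite leq_divRL//; have := TA J.+1; rewrite TS; lia.
have sumJ : (K J + free_blocks A K p m J.+1 <=
    \sum_(0 <= i < m) free_blocks A K p m i)%N.
  have Jm : (J.+2 <= m)%N by have := ltA J.+1; lia.
  rewrite -FJ (big_cat_nat (leq0n _) Jm)//= !big_nat_recr//=.
  by lia.
suff : l * m%:R - p%:R <= p%:R * ((K J)%:R + (free_blocks A K p m J.+1)%:R).
  move=> /le_trans; apply; rewrite -natrD ler_wpM2l// ler_nat; exact: sumJ.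
have KpJ := Kp J; have KpS := Kp J.+1; have lAJ := lA J.+1; have lAS := lA J.+2.
have p0R : 0 < p%:R :> R by rewrite ltr0n.
(* Inside the free word only an unfinished period is lost, since time there counts at full rate and
   [l <= 1]. After it, [m <= A J.+2], and the word just ended suffices by [lAS]. *)
have [mT|Tm] := ltnP m (T J.+2).
  have -> : free_blocks A K p m J.+1 = ((m - A J.+1) %/ p)%N.
    apply/minn_idPr; apply: (@leq_trans ((K J.+1 * p) %/ p)%N); last by rewrite mulnK.
    by apply: leq_div2r; move: mT; rewrite TS; clear; lia.
  have divm : (m <= (m - A J.+1) %/ p * p + A J.+1 + p)%N.
    by move: (divn_eq (m - A J.+1) p) (ltn_pmod (m - A J.+1) p0); clear; lia.
  have : m%:R <= ((m - A J.+1) %/ p)%N%:R * p%:R + (A J.+1)%:R + p%:R :> R.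
    by rewrite -natrM -!natrD ler_nat.
  have Am : 0 <= m%:R - (A J.+1)%:R :> R by rewrite subr_ge0 ler_nat.
  have l1' : 0 <= 1 - l by lra.
  have := mulr_ge0 l1' Am; lra.
have -> : free_blocks A K p m J.+1 = K J.+1.
  by apply/minn_idPl; rewrite leq_divRL//; move: Tm; rewrite TS; clear; lia.
have mA : m%:R <= (A J.+2)%:R :> R by rewrite ler_nat ltnW.
have := ler_wpM2l l0 mA; have : 0 <= p%:R * (K J)%:R :> R by rewrite mulr_ge0.
lra.
Qed.

End Counting.

(** * Transitive and irregular points *)

Section TransitiveIrregular.
Context {R : realType} {X : pmetricType R}.
Implicit Types (f : X -> X) (d e : R) (x z : nat -> X).

Lemma injective_unbounded (g : nat -> nat) (k0 N : nat) :
  injective g -> exists2 k, (k0 <= k)%N & (N <= g k)%N.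
Proof.
move=> gI; apply: contrapT => nok.
have ltgN (i : 'I_N.+1) : (g (k0 + i) < N)%N.
  by rewrite ltnNge; apply/negP => Ng; apply: nok; exists (k0 + i)%N; rewrite ?leq_addr.
have : injective (fun i => Ordinal (ltgN i)).
  by move=> i j [/gI/addnI/val_inj].
by move/leq_card; rewrite !card_ord ltnn.
Qed.

Lemma finite_net e : compact [set: X] -> 0 < e ->
  exists s : seq X, forall w, exists2 v, v \in s & mdist w v < e.
Proof.
rewrite compact_cover => Xc e0.
have [||E _ EX] := Xc X setT (fun v => (ball v e)°).
- by move=> v _; exact: open_interior.
- by move=> v _; exists v => //; apply: nbhsx_ballx.
exists (finmap.enum_fset E) => w; have [//|v vE /interior_subset] := EX w.
by rewrite ballEmdist/= metric_sym => vw; exists v.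
Qed.

(** The sequence enumerates pairs [(k, b)], naming the [b]-th point of a finite [1/(k+1)]-net. The
    pairs that approximate [w] have distinct codes, so they occur at arbitrarily large indices. *)
Lemma recurrent_dense_sequence : compact [set: X] ->
  exists y : nat -> X, forall w e N, 0 < e -> exists2 j, (N <= j)%N & mdist w (y j) < e.
Proof.
move=> Xc; have : forall k, exists s : seq X,
    forall w, exists2 v, v \in s & mdist w v < (k.+1%:R : R)^-1.
  by move=> k; apply: finite_net; rewrite ?invr_gt0.
case/choice => s sP.
exists (fun j => if @choice.unpickle (nat * nat)%type j is Some (k, b) then nth point (s k) b else point).
move=> w e N e0; have : forall k, exists b, mdist w (nth point (s k) b) < (k.+1%:R : R)^-1.
  move=> k; have [v vs wv] := sP k w; exists (index v (s k)).
  by rewrite nth_index.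
case/choice => b bP.
have bI : injective (fun k => choice.pickle (k, b k)).
  by move=> k k' /(pcan_inj (@choice.pickleK _)) [].
have [k kB kN] := injective_unbounded (Num.bound e^-1) N bI.
exists (choice.pickle (k, b k)) => //; rewrite choice.pickleK; apply: lt_trans (bP k) _.
rewrite invf_plt ?posrE//; apply: lt_le_trans (archi_boundP _) _.
  by rewrite invr_ge0 ltW.
by rewrite ler_nat ltnW.
Qed.

Lemma transitive_point f w :
  (forall v e N, 0 < e -> exists2 t, (N <= t)%N & mdist v (iter t f w) < e) ->
  Trans f w.
Proof.
move=> visit; apply/seteqP; split=> // v _ P Q [N _ NP] /nbhs_ballP[e /= e0 eQ].
have [t Nt vt] := visit v e N e0.
exists (iter t f w); split; first exact: NP.
by apply: eQ; rewrite ballEmdist.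
Qed.

(** For [0 < d], a cutoff equal to 1 up to Bowen distance [3 * d] and to 0 from [4 * d] on. *)
Definition bump f n d (v w : X) : R :=
  Num.max 0 (Num.min 1 (4 - d^-1 * bowen_dist f n v w)).

Lemma continuous_bump f n d v : continuous f -> continuous (bump f n d v).
Proof.
move=> fc w; rewrite /bump.
apply: (@continuous_max _ _ (cst 0) (fun w => Num.min 1 (4 - d^-1 * bowen_dist f n v w))).
  exact: cvg_cst.
apply: (@continuous_min _ _ (cst 1) (fun w => 4 - d^-1 * bowen_dist f n v w)).
  exact: cvg_cst.
apply: cvgB; first exact: cvg_cst.
by apply: cvgM; [exact: cvg_cst|exact: continuous_bowen_dist].
Qed.

Lemma bump_ge0 f n d v w : 0 <= bump f n d v w.
Proof. by rewrite /bump le_max lexx. Qed.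

Lemma bump_near f n d v w : 0 < d -> bowen_dist f n v w <= 2 * d ->
  bump f n d v w = 1.
Proof.
move=> d0 vw; have : d^-1 * bowen_dist f n v w <= 2 by rewrite ler_pdivrMl// mulrC.
by rewrite /bump => h; rewrite min_l ?max_r//; lra.
Qed.

Lemma bump_far f n d v w : 0 < d -> 4 * d <= bowen_dist f n v w ->
  bump f n d v w = 0.
Proof.
move=> d0 vw; have : 4 <= d^-1 * bowen_dist f n v w by rewrite ler_pdivlMl// mulrC.
by rewrite /bump => h; rewrite max_l// ge_min; apply/orP; right; lra.
Qed.

(** A point within [4 * d] of two centres would put them within [8 * d], so at most one bump is
    nonzero. *)
Lemma sum_bump_le1 f n d q x w : 0 < d ->
    (forall a b, (a < q)%N -> (b < q)%N -> a != b ->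
      8 * d < bowen_dist f n (x a) (x b)) ->
  \sum_(a < q) bump f n d (x a) w <= 1.
Proof.
move=> d0 xsep.
have le1 (a : nat) : bump f n d (x a) w <= 1 by rewrite /bump ge_max ler01 ge_min lexx.
have [[a near]|far] := pselect (exists a : 'I_q, bowen_dist f n (x a) w < 4 * d).
  rewrite (bigD1 a)//= big1 ?addr0// => b ba; apply: bump_far => //.
  rewrite leNgt; apply/negP => near_b.
  have := xsep a b (ltn_ord a) (ltn_ord b); rewrite eq_sym (inj_eq val_inj) => /(_ ba).
  have := bowen_dist_triangle f n (x a) w (x b).
  rewrite (bowen_dist_sym f n w); lra.
rewrite big1// => a _; apply: bump_far => //.
by rewrite leNgt; apply/negP => ?; apply: far; exists a.
Qed.

Lemma sum_spaced_ge (u : nat -> R) (b m p : nat) :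
    (0 < p)%N -> (forall k, 0 <= u k) -> (forall i, (i < m)%N -> u (b + i * p)%N = 1) ->
  \sum_(0 <= k < b) u k + m%:R <= \sum_(0 <= k < b + m * p) u k.
Proof.
move=> p0 u0; elim: m => [|m IH] u1; first by rewrite mul0n addn0 addr0.
have mm1 : (b + m * p <= b + m.+1 * p)%N by rewrite leq_add2l leq_mul2r leqnSn orbT.
have mm2 : (b + m * p < b + m.+1 * p)%N by rewrite ltn_add2l ltn_mul2r p0 ltnSn.
rewrite (big_cat_nat (leq0n _) mm1)/= -natr1 addrA.
apply: lerD; first by apply: IH => i im; apply: u1; lia.
rewrite big_ltn//.
by rewrite u1// lerDl sumr_ge0.
Qed.

(* If all averages [birkhoff (bump (x a))] converged, the runs of copies of [x a] would
   force each limit to be at least [1/p]; disjointness of the supports then gives [q <= p]. *)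
Lemma irregular_point f n d q p C x (S m : nat -> nat) w :
    continuous f -> 0 < d -> (0 < p < q)%N ->
    (forall a b, (a < q)%N -> (b < q)%N -> a != b ->
      8 * d < bowen_dist f n (x a) (x b)) ->
    (forall j, (j < S j)%N) -> (forall j, (S j + q * m j * p <= C * m j)%N) ->
    (forall j a i, (a < q)%N -> (i < m j)%N ->
      bowen_dist f n (x a) (iter (S j + (a * m j + i) * p) f w) <= 2 * d) ->
  IR f w.
Proof.
move=> fc d0 /andP[p0 pq] xsep ltS SC close; apply: contrapT => regular.
pose phi (a : nat) := bump f n d (x a).
pose c a := limn (birkhoff f (phi a) w).
have birk_cvg a : birkhoff f (phi a) w @ \oo --> c a.
  apply: contrapT => ndiv; apply: regular; exists (phi a); first exact: continuous_bump.
  by move=> cv; exact: ndiv.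
pose B a N := \sum_(0 <= k < N) phi a (iter k f w).
have birkE a N : birkhoff f (phi a) w N = N%:R^-1 * B a N.
  by rewrite /birkhoff /B big_mkord.
(* Makes the total error [q * g * (p + 2 * C)] less than 1/2, against the margin 1 in [p < q]. *)
pose g : R := (2 * q%:R * (p%:R + 2 * C%:R) + 1)^-1.
have p0R : 0 < p%:R :> R by rewrite ltr0n.
have q0R : 0 < q%:R :> R by rewrite ltr0n; lia.
have C0R : 0 <= C%:R :> R by [].
have den0 : 0 < 2 * q%:R * (p%:R + 2 * C%:R) + 1 :> R.
  by rewrite ltr_wpDl// !mulr_ge0// ?addr_ge0// ?mulr_ge0// ltW.
have g0 : 0 < g by rewrite invr_gt0.
have [N0 _ N0P] : \forall N \near \oo, forall a : 'I_q, `|c a - birkhoff f (phi a) w N| < g.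
  by apply: filter_forall => a; move/cvgrPdist_lt: (birk_cvg a); apply.
pose j := N0.+1.
have bounds (a : 'I_q) N : (j <= N)%N -> (c a - g) * N%:R <= B a N <= (c a + g) * N%:R.
  move=> jN; have /= := N0P N (ltnW jN) a; rewrite birkE.
  have N0' : 0 < N%:R :> R by rewrite ltr0n; move: jN; rewrite /j; lia.
  rewrite ltr_distlC => /andP[h1 h2]; apply/andP; split.
    by rewrite mulrC -ler_pdivlMl// ltW//; lra.
  by rewrite mulrC -ler_pdivrMl// ltW.
have Sj := ltS j; have SCj := SC j.
have m0 : (0 < m j)%N by case: (m j) SCj => //; rewrite !muln0; lia.
have m0R : 0 < (m j)%:R :> R by rewrite ltr0n.
(* The sums up to both ends of the run differ by at least [m j]. The errors of the two estimates add
   up to at most [2 * g * C * m j], because the run is proportional to the elapsed time. *)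
have c_ge (a : 'I_q) : 1 <= c a * p%:R + 2 * g * C%:R.
  have aq := ltn_ord a; pose b := (S j + a * m j * p)%N.
  have run : B a b + (m j)%:R <= B a (b + m j * p)%N.
    apply: sum_spaced_ge => // [k|i im]; first exact: bump_ge0.
    by apply: bump_near => //; rewrite /b -addnA -mulnDl; exact: close.
  have bC : (b + m j * p <= C * m j)%N.
    apply: leq_trans SCj; rewrite /b -addnA leq_add2l -mulnDl leq_mul2r -mulSnr.
    by rewrite leq_mul2r aq !orbT.
  have jb : (j <= b)%N by rewrite /b; lia.
  have /andP[lo _] := bounds a b jb.
  have /andP[_ hi] := bounds a (b + m j * p)%N (leq_trans jb (leq_addr _ _)).
  have bCR : (b + m j * p)%:R <= C%:R * (m j)%:R :> R by rewrite -natrM ler_nat.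
  have gbC := ler_wpM2l (ltW g0) bCR; have gb : 0 <= g * (m j * p)%:R by rewrite mulr_ge0// ltW.
  rewrite -(ler_pM2r m0R).
  move: lo hi run bCR gbC gb; rewrite natrD natrM; lra.
have c_le : \sum_(a < q) (c a - g) <= 1.
  have j0 : 0 < j%:R :> R by rewrite ltr0n.
  rewrite -(ler_pM2r j0) mul1r mulr_suml.
  apply: (@le_trans _ _ (\sum_(a < q) B a j)).
    by apply: ler_sum => a _; have /andP[] := bounds a j (leqnn _).
  rewrite /B exchange_big/=; apply: (@le_trans _ _ (\sum_(0 <= k < j) 1)).
    by apply: ler_sum => k _; exact: sum_bump_le1.
  by rewrite sumr_const_nat subn0.
have : \sum_(a < q) 1 <= \sum_(a < q) ((c a - g) * p%:R + g * (p%:R + 2 * C%:R)).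
  by apply: ler_sum => a _; have := c_ge a; lra.
rewrite big_split/= -mulr_suml !sumr_const card_ord -[leLHS]/(q%:R) -mulr_natl.
have pqR : p%:R + 1 <= q%:R :> R by rewrite natr1 ler_nat.
have gE : g * (2 * q%:R * (p%:R + 2 * C%:R) + 1) = 1 by rewrite mulVf// gt_eqF.
have := ler_wpM2r (ltW p0R) c_le.
lra.
Qed.

End TransitiveIrregular.

(** * The construction *)

Section Construction.
Context {R : realType} {X : pmetricType R}.
Context (f : X -> X) (M : nat -> R -> nat) (d : R) (n q : nat) (x y : nat -> X).
Context (T K m : nat -> nat) (C : nat).

Let p : nat := (n + M n d)%N.
(** Stage [j] shadows within [r j.+1]; the errors of stage [j] and all later ones add up to
    [r j]. *)
Let r (j : nat) : R := d * 2^-1 ^+ j.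
Let S (j : nat) : nat := (T j + M (T j) (r j.+1) + M 1%N (r j.+1))%N.
Let A (j : nat) : nat := (S j + q * m j * p)%N.

Context (X_compact : compact [set: X]) (f_cont : continuous f).
Context (M_gap : gap_function f M) (d_gt0 : 0 < d) (n_gt0 : (0 < n)%N) (ltpq : (p < q)%N).
Context (x_sep : forall a b, (a < q)%N -> (b < q)%N -> a != b ->
  12 * d < bowen_dist f n (x a) (x b)).
Context (y_dense : forall w e N, 0 < e -> exists2 j, (N <= j)%N & mdist w (y j) < e).
Context (T0_gt0 : (0 < T 0)%N) (TS : forall j, (T j.+1 = A j + K j * p)%N).
Context (leA : forall j, (A j <= C * m j)%N).

Let r_gt0 j : 0 < r j.
Proof. by rewrite mulr_gt0// exprn_gt0// invr_gt0. Qed.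

Let r_half j : r j = 2 * r j.+1.
Proof. by rewrite /r exprS mulrCA mulVKf. Qed.

Let r_le j : r j <= d.
Proof. by rewrite ler_piMr ?(ltW d_gt0)// exprn_ile1 ?invr_ge0//; lra. Qed.

Let r_small e : 0 < e -> exists N, forall j, (N <= j)%N -> r j < e.
Proof.
move=> e0; exists (Num.bound (d / e)) => j Nj.
have : d / e < 2 ^+ j.
  apply: lt_trans (archi_boundP _) _; first by rewrite divr_ge0 ?ltW.
  by rewrite -natrX ltr_nat (leq_ltn_trans Nj)// ltn_expl.
by rewrite /r exprVn ltr_pdivrMr// ltr_pdivrMr ?exprn_gt0// mulrC.
Qed.

Let p_gt0 : (0 < p)%N. Proof. by rewrite /p; lia. Qed.

Let leTA j : (T j <= A j)%N. Proof. by rewrite /A /S; lia. Qed.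

Let ltTS j : (T j < S j)%N.
Proof.
have [Mpos _ _ _] := M_gap; have := Mpos 1%N (r j.+1) isT (r_gt0 _).
by rewrite /S; lia.
Qed.

Let leSA j : (S j <= A j)%N. Proof. exact: leq_addr. Qed.

Let leAT j : (A j <= T j.+1)%N. Proof. by rewrite TS leq_addr. Qed.

Let ltjT j : (j < T j)%N.
Proof.
elim: j => // j IH; apply: leq_ltn_trans IH _.
by apply: leq_trans (ltTS j) _; apply: leq_trans (leSA j) _.
Qed.

Let ltjA j : (j < A j)%N. Proof. exact: leq_trans (ltjT j) _. Qed.

Let m_gt0 j : (0 < m j)%N.
Proof. by have := leA j; have := ltjA j; case: (m j); rewrite ?muln0; lia. Qed.

(* One stage of the construction: [T j] is the length of the orbit already fixed, [S j]
   the start of the runs [0^m 1^m ... (q-1)^m], [A j] the start of the free word. *)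
Definition linked (j : nat) (z z' : X) : Prop :=
  [/\ forall i, (i < T j)%N -> mdist (iter i f z) (iter i f z') <= r j.+1,
      mdist (y j) (iter (T j + M (T j) (r j.+1)) f z') <= r j.+1 &
      forall a i l, (a < q)%N -> (i < m j)%N -> (l < n)%N ->
        mdist (iter l f (x a)) (iter (S j + (a * m j + i) * p + l) f z') <=
          d + r j.+1].

(** The coded blocks are glued into one orbit with accuracy [d], which is then attached to [z] and
    [y j] with accuracy [r j.+1]. *)
Lemma exists_stage j z (s : {ffun 'I_(K j) -> 'I_q}) :
  exists z', linked j z z' /\
    forall (k : 'I_(K j)) l, (l < n)%N ->
      mdist (iter l f (x (s k))) (iter (A j + k * p + l) f z') <= d + r j.+1.
Proof.
(* Codes [0^m 1^m ... (q-1)^m s]; the final 0 is not reached below [L]. *)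
pose v i := if (i < q * m j)%N then (i %/ m j)%N
            else if insub (i - q * m j)%N is Some k then s k : nat else 0%N.
pose L := (q * m j + K j)%N.
have m0 := m_gt0 j.
have L2 : (2 <= L)%N.
  have : (q <= q * m j)%N by rewrite leq_pmulr.
  by move: ltpq p_gt0; rewrite /L; lia.
have [w wP] := glue_blocks (x \o v) M_gap d_gt0 n_gt0 L2.
have Lp0 : (0 < L * p)%N by rewrite muln_gt0 p_gt0 (leq_trans _ L2).
have [z' [zz' yz' wz']] :=
  glue_stage z (y j) w M_gap (r_gt0 j.+1) (leq_ltn_trans (leq0n _) (ltjT j)) Lp0.
have wz i l : (i < L)%N -> (l < n)%N ->
    mdist (iter l f (x (v i))) (iter (S j + i * p + l) f z') <= d + r j.+1.
  move=> iL ln; apply: le_trans (metric_triangle _ (iter (i * p + l) f w) _) _.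
  apply: lerD; first exact: wP.
  rewrite -addnA; apply: wz'.
  have : (i.+1 * p <= L * p)%N by rewrite leq_mul2r iL orbT.
  by rewrite mulSn {1}/p; lia.
exists z'; split; first split=> //.
  move=> a i l aq im ln.
  have amL : (a * m j + i < q * m j)%N.
    have : (a.+1 * m j <= q * m j)%N by rewrite leq_mul2r aq orbT.
    by rewrite mulSn; lia.
  have := wz (a * m j + i)%N l (leq_trans amL (leq_addr _ _)) ln.
  by rewrite /v amL divnMDl// divn_small// addn0.
move=> k l ln; have := wz (q * m j + k)%N l; rewrite ltn_add2l ltn_ord => /(_ isT ln).
by rewrite /v ltnNge leq_addr/= addKn valK mulnDl addnA.
Qed.

(** Any cluster point serves: at times below [T j] all later stages stay within [r j] of [z j]. *)
Lemma exists_limit (z : nat -> X) :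
    (forall j, linked j (z j) (z j.+1)) ->
  exists w, forall j i, (i < T j)%N -> mdist (iter i f (z j)) (iter i f w) <= r j.
Proof.
move=> zP.
have TT j k : (j <= k)%N -> (T j <= T k)%N.
  elim: k => [|k IH]; first by rewrite leqn0 => /eqP->.
  rewrite leq_eqVlt => /predU1P[->//|/IH/leq_trans]; apply.
  exact: leq_trans (leTA k) (leAT k).
(* Subtracting [r (j + k)] makes the induction telescope. *)
have far j k i : (i < T j)%N ->
    mdist (iter i f (z j)) (iter i f (z (j + k)%N)) <= r j - r (j + k)%N.
  move=> iT; elim: k => [|k IH]; first by rewrite addn0 mdistxx subrr.
  apply: le_trans (metric_triangle _ (iter i f (z (j + k)%N)) _) _.
  have [+ _ _] := zP (j + k)%N; move=> /(_ i (leq_trans iT (TT _ _ (leq_addr _ _)))).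
  by rewrite addnS; have := r_half (j + k)%N; lra.
have [w [_ cw]] := X_compact (F := z @ \oo) _ filterT.
exists w => j i iT; apply/ler_addgt0Pr => e e0.
have nearw : nbhs w [set v | mdist (iter i f w) (iter i f v) < e].
  have : nbhs w (iter i f @^-1` ball (iter i f w) e).
    by apply: continuous_iter => //; exact: nbhsx_ballx.
  by apply: filterS => v; rewrite /= ballEmdist.
have tail : (z @ \oo) [set z k | k in [set k | (j <= k)%N]].
  by exists j => // k /= jk; exists k.
have [_ [[k jk <-]/=]] := cw _ _ tail nearw.
have := far j (k - j)%N i iT; rewrite subnKC// => h1 h2.
have := metric_triangle (iter i f (z j)) (iter i f (z k)) (iter i f w).
rewrite (metric_sym (iter i f (z k))); have := ltW (r_gt0 k); lra.
Qed.

(** On the runs the error is [d + 2 * r j.+1 = d + r j], at most [2 * d]; at the visits to [y j] it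
    tends to 0. *)
Lemma limit_transitive_irregular (z : nat -> X) w :
    (forall j, linked j (z j) (z j.+1)) ->
    (forall j i, (i < T j)%N -> mdist (iter i f (z j)) (iter i f w) <= r j) ->
  (IR f `&` Trans f) w.
Proof.
have d0 := d_gt0; move=> zP zw; split.
  apply: (@irregular_point _ _ f n d q p C x S m) => //.
  - by rewrite p_gt0.
  - move=> a b aq bq ab; apply: lt_trans (x_sep aq bq ab); lra.
  - by move=> j; exact: ltn_trans (ltjT j) (ltTS j).
  - move=> j a i aq im; apply/bowen_dist_leP => [|l ln]; first by lra.
    have [_ _ /(_ a i l aq im ln)] := zP j; rewrite -iterD (addnC l) => h.
    apply: le_trans (metric_triangle _ (iter (S j + (a * m j + i) * p + l) f (z j.+1)) _) _.
    have tT : (S j + (a * m j + i) * p + l < T j.+1)%N.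
      apply: leq_trans (leAT j).
      have : ((a * m j + i).+1 * p <= q * m j * p)%N.
        rewrite leq_mul2r; apply/orP; right.
        have : (a.+1 * m j <= q * m j)%N by rewrite leq_mul2r aq orbT.
        by rewrite mulSn; lia.
      by rewrite mulSn {1}/p /A; lia.
    by have := zw _ _ tT; have := r_half j; have := r_le j; lra.
apply: transitive_point => v e N e0.
have e30 : 0 < e / 3 by lra.
have [N' rN'] := r_small e30.
have [j jN vj] := y_dense v (maxn N N') e30.
exists (T j + M (T j) (r j.+1))%N; first by have := ltjT j; lia.
have [_ yz _] := zP j.
have tT : (T j + M (T j) (r j.+1) < T j.+1)%N.
  apply: leq_trans (leAT j); apply: leq_trans (leSA j).
  have [Mpos _ _ _] := M_gap; have := Mpos 1%N (r j.+1) isT (r_gt0 _).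
  by rewrite /S; lia.
have rj : r j.+1 < e / 3 by apply: rN'; lia.
have := zw _ _ tT.
have := metric_triangle v (y j) (iter (T j + M (T j) (r j.+1)) f w).
have := metric_triangle (y j) (iter (T j + M (T j) (r j.+1)) f (z j.+1))
  (iter (T j + M (T j) (r j.+1)) f w).
lra.
Qed.

(** * Choosing free words against a family of Bowen balls *)

Context (D : set nat) (c : nat -> X) (len : nat -> nat).

Let free (k j : nat) : nat := free_blocks A K p (len k) j.
(* [weight 0 k] bounds the proportion of the choices of free words for which the limit
   point can lie in the [k]-th ball, and [weight j k] the same proportion once the first
   [j] words are fixed. *)
Let weight (j k : nat) : R := q%:R^-1 ^+ (\sum_(j <= i < len k) free k i).
(** The slack [r j] covers all later displacement, so a ball containing the limit point is met at
    every stage. *)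
Let meets (j : nat) (z : X) (k : nat) : bool :=
  bowen_dist f (minn (len k) (T j)) (c k) z < d + r j.
(** Bounds the expected number of balls hit when the remaining words are random. *)
Let potential (j : nat) (z : X) : \bar R :=
  (\esum_(k in D) (if meets j z k then weight j k else 0)%:E)%E.

Let weight_ge0 j k : 0 <= weight j k.
Proof. by rewrite exprn_ge0// invr_ge0. Qed.

Let weightS j k : weight j k = weight j.+1 k * q%:R^-1 ^+ free k j.
Proof.
rewrite /weight -exprD; congr (_ ^+ _); have [jk|kj] := ltnP j (len k).
  by rewrite big_ltn// addnC.
rewrite !big_geq//; last exact: leqW.
rewrite /free /free_blocks (_ : (len k - A j)%N = 0%N) ?div0n ?minn0//.
by have := ltjA j; lia.
Qed.

Let meets_linked j z z' k : linked j z z' -> meets j.+1 z' k -> meets j z k.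
Proof.
move=> [zz' _ _] /bowen_dist_ltP h; apply/bowen_dist_ltP => [|i].
  by rewrite addr_gt0.
rewrite ltn_min => /andP[ik iT].
have iT' : (i < minn (len k) (T j.+1))%N.
  by rewrite ltn_min ik (leq_trans iT)// (leq_trans (leTA j)).
have h' := h (addr_gt0 d_gt0 (r_gt0 _)) i iT'.
apply: le_lt_trans (metric_triangle _ (iter i f z') _) _.
have := zz' i iT; rewrite (metric_sym (iter i f z)); have := r_half j; lra.
Qed.

(** Words whose child meets the [k]-th ball follow the orbit of [c k], hence agree on their first
    [free k j] letters. Their proportion is thus at most the ratio of consecutive weights, and
    averaging applies. *)
Lemma exists_child j z : (potential j z < 1)%E ->
  exists z', linked j z z' /\ (potential j.+1 z' < 1)%E.
Proof.
have d0 := d_gt0; move=> potz; have /choice[Z ZP] := @exists_stage j z.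
pose b s k := if meets j.+1 (Z s) k then weight j.+1 k else 0.
have q_gt0 : (0 < q)%N by apply: leq_ltn_trans ltpq.
suff [s potZ] : exists s, (\esum_(k in D) (b s k)%:E < 1)%E.
  by exists (Z s); have [lZ _] := ZP s; split.
apply: exists_child_below_average potz.
- by rewrite card_ffun !card_ord expn_gt0 q_gt0.
- by move=> s k; rewrite /b; case: ifP.
- by move=> k; case: ifP.
move=> k Dk; rewrite /b -big_mkcond sumr_const.
set P := [pred s | meets j.+1 (Z s) k].
have [s0 s0P|P0] := pickP P; last first.
  by rewrite eq_card0// mulr0n mulr_ge0//; case: ifP.
rewrite (meets_linked (proj1 (ZP s0)) s0P) (weightS j) -[leLHS]mulr_natl.
rewrite [leRHS]mulrA [leRHS]mulrAC ler_wpM2r//.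
rewrite exprVn ler_pdivlMr ?exprn_gt0 ?ltr0n// -natrX -natrM ler_nat.
rewrite card_ffun !card_ord; apply: card_agree_prefix; first exact: geq_minl.
move=> s s' sP s'P i; rewrite /free ltn_min => /andP[iK ik].
have iA : (A j + i * p + n <= len k)%N.
  have : (i.+1 * p <= len k - A j)%N by rewrite -leq_divRL.
  by rewrite mulSn {1}/p; lia.
have iT : (A j + i * p + n <= T j.+1)%N.
  have : (i.+1 * p <= K j * p)%N by rewrite leq_mul2r iK orbT.
  by rewrite mulSn {1}/p TS; lia.
have dr0 : 0 < d + r j.+1 by rewrite addr_gt0.
(* Two errors of [d + r j.+1] make at most [4 * d], so distinct letters would be within [8 * d],
   against the separation [12 * d]. *)
have closeP u : u \in P -> bowen_dist f n (x (u i)) (iter (A j + i * p) f (c k)) <= 4 * d.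
  move=> uP; apply/bowen_dist_leP => [|l ln]; first by lra.
  have tk : (A j + i * p + l < len k)%N by apply: leq_trans iA; rewrite ltn_add2l.
  have tT : (A j + i * p + l < T j.+1)%N by apply: leq_trans iT; rewrite ltn_add2l.
  have := proj2 (ZP u) i l ln.
  have /(bowen_dist_ltP _ _ _ _ dr0)/(_ (A j + i * p + l)%N) := uP.
  rewrite ltn_min -iterD (addnC l) => h1 h2.
  have {}h1 := h1 (introT andP (conj tk tT)).
  have := metric_triangle (iter l f (x (u i))) (iter (A j + i * p + l) f (Z u))
    (iter (A j + i * p + l) f (c k)).
  rewrite (metric_sym (iter _ f (Z u))); have := r_le j.+1; lra.
apply/eqP/negPn/negP => ss'.
have := x_sep (ltn_ord (s i)) (ltn_ord (s' i)); rewrite (inj_eq val_inj) => /(_ ss').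
have := bowen_dist_triangle f n (x (s i)) (iter (A j + i * p) f (c k)) (x (s' i)).
have := closeP s sP; have := closeP s' s'P; rewrite (bowen_dist_sym f n (x (s' i))); lra.
Qed.

(** If the limit point lay in the [k]-th ball, stage [len k] would meet it with weight 1, an empty
    product, and its potential would be at least 1. *)
Lemma exists_avoiding_point : (\esum_(k in D) (weight 0 k)%:E < 1)%E ->
  exists2 w, (IR f `&` Trans f) w & forall k, D k -> ~ bowen_ball f (len k) (c k) d w.
Proof.
have d0 := d_gt0; move=> w1.
have pot0 : (potential 0 point < 1)%E.
  by apply: le_lt_trans w1; apply: le_esum => k _; rewrite lee_fin; case: ifP.
have /choice[next nextP] : forall jz : nat * X, exists z',
    (potential jz.1 jz.2 < 1)%E -> linked jz.1 jz.2 z' /\ (potential jz.1.+1 z' < 1)%E.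
  move=> [j z]; have [/exists_child[z' z'P]|] := pselect (potential j z < 1)%E.
    by exists z'.
  by exists z.
pose z := fix z j := if j is i.+1 then next (i, z i) else point.
have pot j : (potential j (z j) < 1)%E.
  by elim: j => // j IH; have [] := nextP (j, z j) IH.
have zP j : linked j (z j) (z j.+1) by have [] := nextP (j, z j) (pot j).
have [w zw] := exists_limit zP.
exists w; first exact: limit_transitive_irregular zP zw.
move=> k Dk /(bowen_dist_ltP _ _ _ _ d_gt0) inball.
have mk : meets (len k) (z (len k)) k.
  apply/bowen_dist_ltP => [|i]; first by rewrite addr_gt0.
  rewrite ltn_min => /andP[ik iT].
  have := zw _ _ iT; have := inball i ik.
  have := metric_triangle (iter i f (c k)) (iter i f w) (iter i f (z (len k))).
  rewrite (metric_sym (iter i f w)); lra.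
have := pot (len k); rewrite ltNge => /negP; apply.
apply: esum_ge; exists [set k]; first by split=> // _ ->.
by rewrite fsbig_set1 mk /weight big_geq.
Qed.

End Construction.

(** * Bowen entropy *)

Section BowenEntropy.
Context {R : realType} {X : pmetricType R}.
Implicit Types (f : X -> X) (F : set X) (e t : R).

Lemma le_bowen_ball f n x e e' : e <= e' -> bowen_ball f n x e `<=` bowen_ball f n x e'.
Proof. by move=> ee' y xy; exact: lt_le_trans ee'. Qed.

Lemma bowen_sum_N_ge0 f F t N e : (0 <= bowen_sum_N f F t N e)%E.
Proof.
apply: le_ereal_inf_tmp => _ [D [c [m [_ ->]]]].
by apply: esum_ge0 => k _; rewrite lee_fin expR_ge0.
Qed.

Lemma bowen_sumE f F t e :
  bowen_sum f F t e = ereal_sup (range (fun N => bowen_sum_N f F t N e)).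
Proof.
apply/cvg_lim => //; apply: ereal_nondecreasing_cvgn => N N' NN'.
apply: ereal_inf_le_tmp => _ [D [c [m [[cF mN cov] ->]]]].
exists D, c, m; split=> //; split=> // k /mN; exact: leq_trans.
Qed.

Lemma le_bowen_sum f F t e e' : e <= e' -> (bowen_sum f F t e' <= bowen_sum f F t e)%E.
Proof.
move=> ee'; rewrite !bowen_sumE; apply: ge_ereal_sup => _ [N _ <-].
apply: le_ereal_sup_tmp; exists (bowen_sum_N f F t N e); first by exists N.
apply: ereal_inf_le_tmp => _ [D [c [m [[cF mN cov] ->]]]].
exists D, c, m; split=> //; split=> // x /cov[k Dk xk].
by exists k => //; exact: le_bowen_ball xk.
Qed.

Lemma bowen_sum_ge0 f F t e : (0 <= bowen_sum f F t e)%E.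
Proof.
rewrite bowen_sumE; apply: le_ereal_sup_tmp.
by exists (bowen_sum_N f F t 0 e); [exists 0%N|exact: bowen_sum_N_ge0].
Qed.

Lemma bowen_entropy_at_le f F e : 0 < e -> (bowen_entropy_at f F e <= bowen_entropy f F)%E.
Proof.
move=> e0; have mono : {in Interval (BRight 0) (BInfty R false) &,
    nonincreasing_fun (bowen_entropy_at f F)}.
  move=> e1 e2 _ _ e12; apply: ereal_inf_le_tmp => _ [t [t0 tE] <-].
  exists t => //; split=> //; apply/eqP; rewrite eq_le bowen_sum_ge0 andbT.
  by rewrite -tE le_bowen_sum.
have /cvg_lim := nonincreasing_at_right_cvge (BInfty R false) isT mono.
rewrite /bowen_entropy => ->//; apply: ereal_sup_ubound.
by exists e => //=; rewrite in_itv/= e0.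
Qed.

Lemma bowen_entropy_ge0 f F : (0 <= bowen_entropy f F)%E.
Proof.
apply: le_trans (bowen_entropy_at_le f F ltr01).
by apply: le_ereal_inf_tmp => _ [t [t0 _] <-]; rewrite lee_fin.
Qed.

(** One scale and one [N] suffice because both limits are suprema; passing to [t' < t] only
    increases the weights. *)
Lemma bowen_entropy_ge f F t e N : 0 < e ->
    (forall D c m, bowen_cover f F N e D c m ->
      (1 <= \esum_(k in D) (expR (- t * (m k)%:R))%:E)%E) ->
  (t%:E <= bowen_entropy f F)%E.
Proof.
move=> e0 cov1; apply: le_trans (bowen_entropy_at_le f F e0).
apply: le_ereal_inf_tmp => _ [t' [_ sum0] <-]; rewrite lee_fin leNgt; apply/negP => tt'.
have : (1 <= bowen_sum f F t' e)%E.
  rewrite bowen_sumE; apply: le_ereal_sup_tmp.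
  exists (bowen_sum_N f F t' N e); first by exists N.
  apply: le_ereal_inf_tmp => _ [D [c [m [/cov1/le_trans + ->]]]]; apply.
  apply: le_esum => k _; rewrite lee_fin ler_expR ler_wpM2r//; lra.
by rewrite sum0 lee_fin ler10.
Qed.

End BowenEntropy.

(** * Choice of the parameters *)

Section Schedule.
Context {R : realType} {X : pmetricType R}.
Implicit Types (f : X -> X) (M : nat -> R -> nat) (d t h tau : R).

Definition block_start M d (Q q p j T : nat) : nat :=
  (T + M T (d * 2^-1 ^+ j.+1)%R + M 1%N (d * 2^-1 ^+ j.+1)%R + q * (T %/ Q) * p)%N.

(** For positive [Q] and [k0], the two gaps of the stage cost at most [tau * T] and [T / k0], and
    the run length [T %/ Q] is positive. *)
Definition good_time M d tau (Q k0 j T : nat) : Prop :=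
  [/\ (Q <= T)%N, (M T (d * 2^-1 ^+ j.+1)%R)%:R <= tau * T%:R &
      (k0 * M 1%N (d * 2^-1 ^+ j.+1)%R <= T)%N].

Lemma ltn_block_start f M d (Q q p j T : nat) :
  gap_function f M -> 0 < d -> (T < block_start M d Q q p j T)%N.
Proof.
move=> [Mpos _ _ _] d0; have r0 : 0 < d * 2^-1 ^+ j.+1.
  by rewrite mulr_gt0// exprn_gt0// invr_gt0.
apply: leq_trans (leq_addr _ _); rewrite -addn1 -addnA leq_add2l.
exact: leq_trans (Mpos 1%N _ isT r0) (leq_addl _ _).
Qed.

(** The accuracy of the next stage is known beforehand, so [K j] can be chosen to end the free word
    at a time good for the next gap. *)
Lemma exists_schedule f M tau tau' d (Q k0 q p : nat) :
    gap_function f M -> gap_rate M = tau%:E -> 0 <= tau -> tau < tau' -> 0 < d ->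
    (0 < p)%N ->
  exists T K : nat -> nat, forall j,
    [/\ good_time M d tau' Q k0 j (T j),
        (T j.+1 = block_start M d Q q p j (T j) + K j * p)%N &
        (k0 * block_start M d Q q p j (T j) <= T j.+1)%N].
Proof.
move=> gapM Mtau tau0 ltau d0 p0.
have r0 j : 0 < d * 2^-1 ^+ j by rewrite mulr_gt0// exprn_gt0// invr_gt0.
have large j A P : (0 < P)%N -> exists K, good_time M d tau' Q k0 j (A + K * P)%N /\
    (k0 * A <= A + K * P)%N.
  move=> P0; pose N := (Q + k0 * M 1%N (d * 2^-1 ^+ j.+1)%R + k0 * A)%N.
  have [K NK MK] := gap_rate_frequently_mod A N gapM Mtau tau0 ltau (r0 j.+1) P0.
  have KP : (K <= K * P)%N by rewrite leq_pmulr.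
  by exists K; split; [split=> //|]; move: NK; rewrite /N; lia.
have [T0 [T0good _]] := large 0%N 0%N 1%N isT.
have /choice[next nextP] : forall jT : nat * nat, exists K,
    good_time M d tau' Q k0 jT.1.+1 (block_start M d Q q p jT.1 jT.2 + K * p)%N /\
    (k0 * block_start M d Q q p jT.1 jT.2 <=
       block_start M d Q q p jT.1 jT.2 + K * p)%N.
  by move=> [j T]; exact: large.
pose T := fix T j := if j is i.+1 then
  (block_start M d Q q p i (T i) + next (i, T i) * p)%N else (0 + T0 * 1)%N.
exists T, (fun j => next (j, T j)) => j; split=> //.
- by case: j => [//|j]; have [] := nextP (j, T j).
- by have [] := nextP (j, T j).
Qed.

(** As [g] tends to 0 and [k0] to infinity, the two sides tend to [(1 + tau) ^+ 2 * t] and [h]. *)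
Lemma exists_slack tau t h : 0 <= tau -> 0 <= t -> (1 + tau) ^+ 2 * t < h ->
  exists g k0, [/\ 0 < g, (1 < k0)%N &
    t * (1 + (tau + g)) * (1 + (tau + g) + 2 / k0%:R) < h * (1 - k0%:R^-1)].
Proof.
move=> tau0 t0 ht; pose gap := h - (1 + tau) ^+ 2 * t.
have gap0 : 0 < gap by rewrite /gap; lra.
have h0 : 0 <= h by apply: le_trans (ltW ht); rewrite mulr_ge0 ?sqr_ge0.
(* [g * B] dominates the first-order loss, using [1 / k0 < g] and [g ^ 2 <= g]; the extra 1 gives
   strictness. *)
pose B := t * (4 * (1 + tau) + 3) + h + 1.
have B0 : 0 < B by rewrite /B ltr_wpDl// addr_ge0// mulr_ge0//; lra.
have [g [g0 g1 gB]] : exists g : R, [/\ 0 < g, g <= 1 & g * B <= gap].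
  exists (Num.min 1 (gap / B)); split; rewrite ?lt_min ?ltr01 ?divr_gt0 ?ge_min ?lexx//.
  by rewrite -ler_pdivlMr// ge_min lexx orbT.
pose k0 := (Num.bound g^-1).+2; exists g, k0; split=> //.
have k0g : k0%:R^-1 < g :> R.
  rewrite invf_plt ?posrE//; apply: lt_le_trans (archi_boundP _) _.
    by rewrite invr_ge0 ltW.
  by rewrite ler_nat /k0 -addn2 leq_addr.
have k00 : 0 < k0%:R^-1 :> R by rewrite invr_gt0.
have e1 : t * (1 + (tau + g)) * (1 + (tau + g) + 2 / k0%:R) <=
    t * (1 + (tau + g)) * (1 + (tau + g) + 2 * g).
  by apply: ler_wpM2l; [rewrite mulr_ge0//; lra|lra].
have e2 : h * k0%:R^-1 <= h * g by rewrite ler_wpM2l// ltW.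
have e3 : t * (g * g) <= t * g by rewrite ler_wpM2l// ler_piMr// ltW.
apply: le_lt_trans e1 _.
move: gB gap0 k0g g0; rewrite /B /gap expr2; nra.
Qed.

Lemma expR_gt_linear h t : 0 < h -> exists N : nat, forall n, (N <= n)%N -> (0 < n)%N ->
  t * n%:R < expR (h * n%:R).
Proof.
move=> h0; exists (Num.bound (4 * `|t| / h ^+ 2)) => n Nn n0.
have n0R : 0 < n%:R :> R by rewrite ltr0n.
have tn : 4 * `|t| / h ^+ 2 < n%:R.
  apply: lt_le_trans (archi_boundP _) _; last by rewrite ler_nat.
  by apply: divr_ge0; [exact: mulr_ge0|exact: sqr_ge0].
rewrite ltr_pdivrMr ?exprn_gt0// in tn.
have sq : (h * n%:R / 2) ^+ 2 <= expR (h * n%:R).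
  rewrite (_ : expR (h * n%:R) = expR (h * n%:R / 2) ^+ 2); last first.
    by rewrite -expRM_natl; congr expR; field.
  have hn : 0 <= h * n%:R / 2 by rewrite divr_ge0// mulr_ge0// ltW.
  rewrite lerXn2r ?nnegrE ?expR_ge0//; apply: le_trans (expR_ge1Dx _); lra.
apply: lt_le_trans sq; have : t <= `|t| := ler_norm t.
move=> tt; have := ltr_pM2r n0R (4 * `|t|) (n%:R * h ^+ 2); rewrite tn.
have := ler_wpM2r (ltW n0R) tt.
rewrite !exprMn; lra.
Qed.

(** Order of choices: [h] fixes the scale [d]; then comes a length [n] with small gap and more than
    [p] separated points, then [Q] and the schedule. A cover of weight below 1 would miss a point of
    the set. *)
Lemma irregular_transitive_entropy f M tau t h :
    compact [set: X] -> continuous f -> gap_function f M -> gap_rate M = tau%:E ->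
    0 <= tau -> 0 <= t -> (1 + tau) ^+ 2 * t < h -> (h%:E < h_top f)%E ->
  (t%:E <= bowen_entropy f (IR f `&` Trans f))%E.
Proof.
move=> Xc fc gapM Mtau tau0 t0 ht htop.
have h0 : 0 < h by apply: le_lt_trans ht; rewrite mulr_ge0 ?sqr_ge0.
have [g [k0 [g0 k01 slack]]] := exists_slack tau0 t0 ht.
set tau' := tau + g in slack; have ltau : tau < tau' by rewrite /tau'; lra.
have [e e0 sep] := separated_lower_bound (ltW h0) htop.
pose d := e / 12; have d0 : 0 < d by rewrite /d; lra.
have [N1 N1P] := expR_gt_linear (1 + tau') h0.
have [n nN Mn] := gap_rate_frequently N1.+1 Mtau ltau d0.
have n0 : (0 < n)%N by apply: leq_ltn_trans nN.
have [E sepE qE] := sep n n0.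
pose q := size (finmap.enum_fset E); pose x a := nth point (finmap.enum_fset E) a.
pose p := (n + M n d)%N.
have x_sep a b : (a < q)%N -> (b < q)%N -> a != b -> 12 * d < bowen_dist f n (x a) (x b).
  move=> aq bq ab; rewrite (_ : 12 * d = e); last by rewrite /d; field.
  apply: sepE; [exact: (mem_nth point aq)|exact: (mem_nth point bq)|].
  by rewrite nth_uniq// finmap.fset_uniq.
have pR : p%:R <= (1 + tau') * n%:R :> R by rewrite natrD; lra.
have pq : (p < q)%N.
  by rewrite -(ltr_nat R); apply: le_lt_trans pR _; apply: lt_le_trans (N1P n (ltnW nN) n0) qE.
have p0 : (0 < p)%N by rewrite addn_gt0 n0.
have q0 : (0 < q)%N by exact: leq_ltn_trans pq.
(* With this [Q] the runs take at most [T j / k0]. *)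
have [Q QE] : exists Q, Q = (q * p * k0)%N by eexists.
have Q0 : (0 < Q)%N by rewrite QE !muln_gt0 q0 p0 ltnW.
have [y y_dense] := recurrent_dense_sequence Xc.
have [T [K TK]] := exists_schedule Q k0 q gapM Mtau tau0 ltau d0 p0.
pose A j := block_start M d Q q p j (T j).
have TS j : (T j.+1 = A j + K j * p)%N by have [] := TK j.
have kA j : (k0 * A j <= T j.+1)%N by have [] := TK j.
have QT j : (Q <= T j)%N by have [[]] := TK j.
(* The past orbit and its gap contribute [1 + tau']; the second gap and the runs contribute [1 / k0]
   each. *)
pose D := 1 + tau' + 2 / k0%:R.
have k0R : 0 < k0%:R :> R by rewrite ltr0n ltnW.
have AD j : (A j)%:R <= D * (T j)%:R :> R.
  have [[_ MT M1] _ _] := TK j.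
  have M1R : (M 1%N (d * 2^-1 ^+ j.+1)%R)%:R <= (T j)%:R / k0%:R :> R.
    by rewrite ler_pdivlMr// mulrC -natrM ler_nat.
  have runR : (q * (T j %/ Q) * p)%N%:R <= (T j)%:R / k0%:R :> R.
    rewrite ler_pdivlMr// -natrM ler_nat; apply: leq_trans (leq_trunc_div (T j) Q).
    by move: (T j %/ Q)%N => a; rewrite QE; clear; lia.
  rewrite /A /block_start !natrD /D; lra.
have D1 : 1 <= D by rewrite /D; have : 0 <= 2 / k0%:R :> R by []; rewrite /tau'; lra.
(* The factor 2 pays for rounding: [T j < 2 * Q * (T j %/ Q)], as the quotient is at least 1. *)
pose C := (Num.bound D * 2 * Q)%N.
have AC j : (A j <= C * (T j %/ Q))%N.
  apply: (@leq_trans (Num.bound D * T j)%N).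
    rewrite -(ler_nat R) natrM; apply: le_trans (AD j) _.
    by rewrite ler_wpM2r// ltW// archi_boundP//; lra.
  rewrite /C -!mulnA leq_mul2l; apply/orP; right.
  have m0 : (0 < T j %/ Q)%N by rewrite divn_gt0.
  apply: leq_trans (ltnW (ltn_ceil (T j) Q0)) _.
  by rewrite (mulnC Q) mulnA leq_mul2r mul2n -addnn -addn1 leq_add2l m0 orbT.
have T0 : (0 < T 0)%N by exact: leq_trans Q0 (QT 0%N).
pose l := (1 - k0%:R^-1) / D.
have slack' : t * (1 + tau') < h * l.
  by rewrite /l mulrA ltr_pdivlMr//; lra.
have sl0 : 0 < h * n%:R * l - p%:R * t.
  have n0R : 0 < n%:R :> R by rewrite ltr0n.
  have := ler_wpM2r t0 pR; have := ltr_pM2r n0R (t * (1 + tau')) (h * l); rewrite slack'; lra.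
(* The second term makes [len k] long enough to absorb the period [p] lost in
   [sum_free_blocks_ge]. *)
pose N := (A 1 + Num.bound (h * n%:R * p%:R / (h * n%:R * l - p%:R * t)))%N.
apply: (bowen_entropy_ge (e := d) (N := N) d0) => F c len [cF lenN cov].
rewrite leNgt; apply/negP => small.
have ltTA j : (T j < A j)%N by exact: ltn_block_start gapM d0.
have leTA j : (T j <= A j)%N by exact: ltnW.
have ltjT j : (j < T j)%N.
  elim: j => // j IH; rewrite TS; apply: leq_trans (leq_addr _ _).
  exact: leq_ltn_trans IH (ltTA j).
have [|w wF noball] := @exists_avoiding_point R X f M d n q x y T K (fun j => T j %/ Q)%N C
  Xc fc gapM d0 n0 pq x_sep y_dense T0 TS AC F c len.
  apply: le_lt_trans small; apply: le_esum => k Fk; rewrite lee_fin.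
  set s := (\sum_(0 <= i < len k) _)%N.
  have := sum_free_blocks_ge (R := R) (m := len k) p0 k01 D1 leTA
    (fun j => leq_trans (ltjT j) (leTA j)) TS kA AD (leq_trans (leq_addr _ _) (lenN k Fk)).
  rewrite -/s -/l => sp.
  have q0R : 0 < q%:R :> R by rewrite ltr0n.
  have lnq : h * n%:R <= ln q%:R by rewrite -ler_expR lnK ?posrE.
  rewrite exprVn -[q%:R]lnK ?posrE// -expRM_natl -expRN ler_expR mulNr lerN2.
  have lenR : h * n%:R * p%:R <= (len k)%:R * (h * n%:R * l - p%:R * t).
    rewrite -ler_pdivrMr//; apply: ltW; apply: lt_le_trans (archi_boundP _) _.
      by rewrite divr_ge0 ?mulr_ge0 ?(ltW sl0)// ltW.
    by rewrite ler_nat (leq_trans (leq_addl _ _) (lenN k Fk)).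
  have p0R : 0 < p%:R :> R by rewrite ltr0n.
  have hn0 : 0 <= h * n%:R by rewrite mulr_ge0// ltW.
  apply: (@le_trans _ _ (s%:R * (h * n%:R))); last by rewrite ler_wpM2l.
  rewrite -(ler_pM2l p0R); have := ler_wpM2r hn0 sp; lra.
by have [k Fk wk] := cov _ wF; exact: noball k Fk wk.
Qed.

End Schedule.

(** * Passage to extended real values *)

Lemma lt_EFin_between (R : realType) (a : R) (x : \bar R) : (a%:E < x)%E ->
  exists2 b, a < b & (b%:E < x)%E.
Proof.
case: x => [c| |]//; last by exists (a + 1); rewrite ?ltry// ltrDl.
by rewrite lte_fin => /midf_lt[ac cb]; exists ((a + c) / 2).
Qed.

(* In \bar R, +oo^-1 = 0 and 0 * +oo = 0, so the right-hand side is 0 when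
   tau = +oo. *)
Theorem theorem8 (R : realType) (X : pmetricType R) (f : X -> X)
    (tau : \bar R)
    (X_compact : compact [set: X])
    (X_two_points : exists x y : X, x != y)
    (f_continuous : continuous f)
    (tau_ge0 : (0 <= tau)%E)
    (f_specification : nonuniform_specification f tau) :
  (((1 + tau) ^+ 2)^-1 * h_top f <=
   maxe
     (bowen_entropy f (IR f `&` Trans f))
     (bowen_entropy f
        ((\bigcup_(nu in invariant_measures f `\` ergodic_measures f)
            generic f nu) `&` Trans f)))%E.
Proof.
rewrite le_max; apply/orP; left.
have [[M M_gap M_tau] _] := f_specification.
have ent0 := bowen_entropy_ge0 f (IR f `&` Trans f).
case: tau tau_ge0 M_tau {f_specification} => [s| |]//; last first.
  by move=> _ _; rewrite addey// expe2 mulyy invey mul0e.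
rewrite lee_fin => s0 M_tau.
have c0 : 0 < (1 + s) ^+ 2 by rewrite exprn_gt0//; lra.
rewrite -EFinD -EFin_expe inver gt_eqF//.
apply: contrapT => /negP; rewrite -ltNge => entlt.
(* [h_top f] may be infinite, so a real [t] is inserted strictly between the two sides. *)
have : exists t, [/\ 0 <= t, (bowen_entropy f (IR f `&` Trans f) < t%:E)%E &
    (((1 + s) ^+ 2 * t)%:E < h_top f)%E].
  have entfin : bowen_entropy f (IR f `&` Trans f) \is a fin_num.
    by rewrite ge0_fin_numE// (lt_le_trans entlt)// leey.
  case: (bowen_entropy f _) entfin ent0 entlt => [b| |]// _ b0.
  rewrite lte_pdivlMl// => blt.
  have [h' bh h'h] := lt_EFin_between blt.
  exists (((1 + s) ^+ 2)^-1 * h'); rewrite mulVKf ?gt_eqF// lte_fin ltr_pdivlMl//.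
  split=> //; rewrite mulr_ge0 ?invr_ge0 ?(ltW c0)//.
  by apply: le_trans (ltW bh); rewrite mulr_ge0// ltW.
case=> t [t0 entt tlt].
have [h th hlt] := lt_EFin_between tlt.
have := irregular_transitive_entropy X_compact f_continuous M_gap M_tau s0 t0 th hlt.
by rewrite leNgt entt.
Qed.
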